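(* For every integer $k\ge 2$ there exists a simple planar graph $M_k$ such that \[ |V(M_k)|=31k,\qquad a(M_k)=15k,\qquad \frac{a(M_k)}{|V(M_k)|}=\frac{15}{31}, \] and $\delta(M_k)=5$.
   Context: For a finite graph $G$, $a(G)$ denotes the maximum number of vertices in an induced forest of $G$, i.e. the maximum of $|F|$ over $F\subseteq V(G)$ such that the induced subgraph $G[F]$ is acyclic. $\delta(G)$ denotes the minimum degree of $G$. *)

(* Defs.v *)
From HB Require Import structures.
From mathcomp Require Import all_boot all_order all_algebra.
From mathcomp Require Import all_classical all_reals all_analysis.

Set Implicit Arguments.
Unset Strict Implicit.
Unset Printing Implicit Defensive.

Import Order.TTheory GRing.Theory Num.Theory.
Import numFieldNormedType.Exports.

Local Open Scope classical_set_scope.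
Local Open Scope ring_scope.

Record sgraph := SGraph {
  vertex :> finType;
  adj : rel vertex;
  adj_sym : symmetric adj;
  adj_irrefl : irreflexive adj }.

Definition induced_subgraph (G : sgraph) (F : {set G}) : sgraph :=
  @SGraph {x : G | x \in F} (relpre val (@adj G))
    (fun x y => adj_sym (val x) (val y)) (fun x => adj_irrefl (val x)).

(* [ucycle] also accepts the empty sequence and the pairs [:: x; y] with
   [adj x y]; graph cycles are the ones of length at least 3. *)
Definition acyclic (G : sgraph) : Prop :=
  forall c : seq G, (3 <= size c)%N -> ~ ucycle (@adj G) c.

(* a(G) *)
Definition forest_number (G : sgraph) : nat :=
  \max_(F : {set G} | `[< acyclic (induced_subgraph F) >]) #|F|.

Definition degree (G : sgraph) (x : G) : nat := #|[set y | adj x y]%SET|.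

(* Every degree is less than #|G|, so the default value of [\big] does not
   affect the minimum of a nonempty graph. *)
Definition min_degree (G : sgraph) : nat :=
  \big[minn/#|G|]_(x : G) degree x.

(* A is a (non-closed) Jordan arc of the plane with endpoints a and b. *)
Definition is_arc (R : realType) (a b : R * R) (A : set (R * R)) : Prop :=
  exists g : R -> R * R,
    [/\ {within `[0, 1], continuous g},
        {in `[0, 1] &, injective g},
        g 0 = a, g 1 = b & A = g @` `[0, 1]].

(* The drawing places the vertex x at p x, and draws the edge xy as the arc
   A x y; the interior of an arc meets no vertex and no other arc. *)
Definition is_plane_drawing (R : realType) (G : sgraph)
    (p : G -> R * R) (A : G -> G -> set (R * R)) : Prop :=
  [/\ injective p,
      forall x y, adj x y -> A x y = A y x /\ is_arc (p x) (p y) (A x y),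
      forall x y z, adj x y -> ~ (A x y `\` [set p x; p y]) (p z) &
      forall x y z t, adj x y -> adj z t ->
        [set x; y]%SET != [set z; t]%SET ->
        (A x y `\` [set p x; p y]) `&` A z t = set0].

Definition planar (R : realType) (G : sgraph) : Prop :=
  exists p A, @is_plane_drawing R G p A.

(* Main.v *)
(* M_k consists of k disjoint copies of a planar triangulation on 31 vertices,
   found by computer search, which has minimum degree 5 and in which every set
   of vertices meeting all cycles has at least 16 elements.

   This triangulation is glued along triangles from four pieces: two complete
   graphs {0, 1, 2, 3} and {0, 1, 3, 4}, one piece with 14 further vertices on
   the triangle 0 1 2, and one with 12 further vertices on the triangle 0 3 4.
   How many of the further vertices of a piece must be hit depends only on the
   vertices of its triangle that are avoided; these minima are bounded below by
   branching trees with disjoint cycles at the leaves.  Adding them up over all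
   states of 0, ..., 4 gives 16.

   Planarity is witnessed by a straight-line drawing with integer coordinates,
   whose translates accommodate the k copies. *)
From Stdlib Require Import ZArith.
Require Import Defs.
From mathcomp Require Import all_boot all_order all_algebra.
From mathcomp Require Import all_classical all_reals all_analysis.
From mathcomp Require Import zify ssrZ ring lra.

Set Implicit Arguments.
Unset Strict Implicit.
Unset Printing Implicit Defensive.

Import Order.TTheory GRing.Theory Num.Theory.
Import numFieldNormedType.Exports.

Local Open Scope ring_scope.

Local Delimit Scope Z_scope with coqZ.

(* Vertices 5, ..., 18 lie inside the triangle 0 1 2 and vertices 19, ..., 30
   inside the triangle 0 3 4; {0, 1, 2, 3} and {0, 1, 3, 4} are complete. *)
Definition neighbours : seq (seq nat) :=
  [:: [:: 1; 2; 3; 4; 5; 6; 19; 20]; [:: 0; 2; 3; 4; 5; 7]; [:: 0; 1; 3; 6; 7;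
  8; 9]; [:: 0; 1; 2; 4; 20; 21; 22]; [:: 0; 1; 3; 19; 21; 23]; [:: 0; 1; 6;
  7; 10; 11]; [:: 0; 2; 5; 9; 11]; [:: 1; 2; 5; 8; 10; 12]; [:: 2; 7; 9; 12;
  13; 14]; [:: 2; 6; 8; 11; 14; 15]; [:: 5; 7; 11; 12; 16; 17]; [:: 5; 6; 9;
  10; 15; 16]; [:: 7; 8; 10; 13; 17]; [:: 8; 12; 14; 17; 18]; [:: 8; 9; 13;
  15; 18]; [:: 9; 11; 14; 16; 18]; [:: 10; 11; 15; 17; 18]; [:: 10; 12; 13;
  16; 18]; [:: 13; 14; 15; 16; 17]; [:: 0; 4; 20; 23; 24; 25]; [:: 0; 3; 19;
  22; 24; 26]; [:: 3; 4; 22; 23; 27]; [:: 3; 20; 21; 26; 27; 28]; [:: 4; 19;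
  21; 25; 27; 29]; [:: 19; 20; 25; 26; 30]; [:: 19; 23; 24; 29; 30]; [:: 20;
  22; 24; 28; 30]; [:: 21; 22; 23; 28; 29]; [:: 22; 26; 27; 29; 30]; [:: 23;
  25; 27; 28; 30]; [:: 24; 25; 26; 28; 29]].

Definition badj : rel nat := fun x y => y \in nth [::] neighbours x.

(** * Certificates bounding from below the vertex sets that hit all cycles *)

Inductive certificate :=
  | Done
  | Split of nat & certificate & certificate
  | Cyc of seq nat & certificate.

(* [check I U k t]: the tree t shows that a set hitting all cycles and avoiding
   I has at least k vertices in U.  [Split v] branches on whether v is avoided
   or hit; [Cyc c] uses up a cycle c contained in I and U, of which some vertex
   of U is hit. *)
Fixpoint check (I U : seq nat) (k : nat) (t : certificate) : bool :=
  match t with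
  | Done => k == 0%N
  | Split v t1 t2 =>
      [&& v \in U, check (v :: I) (rem v U) k t1 & check I (rem v U) k.-1 t2]
  | Cyc c t1 =>
      [&& (2 < size c)%N, ucycleb badj c, all (mem (I ++ U)) c
        & check I [seq x <- U | x \notin c] k.-1 t1]
  end.

(** Such an [S] is a feedback vertex set, the complement of an induced forest. *)
Definition hits_cycles (S : pred nat) : Prop :=
  forall c, (2 < size c)%N -> ucycle badj c -> has S c.

(** Induction on the tree. The vertices of [I] are avoided, so a cycle within [I] and [U] is hit at
    a vertex of [U]. All its vertices then leave [U], so later cycles account for other hit
    vertices, even if they share vertices of [I]. *)
Lemma check_sound (S : pred nat) (t : certificate) (I U : seq nat) (k : nat) :
  hits_cycles S -> check I U k t -> ~~ has S I -> (k <= count S U)%N.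
Proof.
move=> hS; elim: t I U k => [|v t1 IH1 t2 IH2|c t1 IH] I U k /=.
- by move/eqP->.
- case/and3P=> vU c1 c2 nI.
  rewrite (permP (perm_to_rem vU)) /=.
  (* An avoided [v] joins [I] and the rest must still supply [k]; a hit [v] is itself one of the
     [k]. *)
  case Sv: (S v) => /=; last by apply: IH1 c1 _; rewrite /= Sv.
  by have := IH2 _ _ _ c2 nI; lia.
- case/and4P=> sc uc /allP cIU c1 nI.
  have {IH c1} := IH _ _ _ c1 nI; rewrite count_filter.
  have /hasP[x xc Sx] := hS c sc uc.
  have xU : x \in U.
    have := cIU _ xc; rewrite /= mem_cat => /orP[xI|//].
    by case/negP: nI; apply/hasP; exists x.
  have : (0 < count (predI S (mem c)) U)%N.
    by rewrite -has_count; apply/hasP; exists x => //=; rewrite Sx.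
  (* The hit vertices split into those on [c], at least one, and those left to the subtree. *)
  have : count S U = (count (predI S (mem c)) U +
      count (predI S (fun y => y \notin c)) U)%N.
    rewrite -size_filter -(count_predC (mem c)) !count_filter.
    by congr (_ + _)%N; apply: eq_count => y /=; rewrite andbC.
  by move=> -> c_gt0 IH'; apply: leq_trans (leqSpred k) (leq_add c_gt0 IH').
Qed.

(* The digits in a name are the vertices of the surrounding triangle that the
   hitting set avoids. *)
Definition certA : certificate :=
  Split 10 (Split 11 (Cyc [:: 5; 10; 11] (Cyc [:: 10; 11; 16] (Cyc [:: 6; 9;
  11] (Cyc [:: 7; 10; 12] (Cyc [:: 8; 13; 14] (Cyc [:: 10; 11; 15; 18; 17]
  Done)))))) (Split 17 (Cyc [:: 10; 12; 17] (Cyc [:: 10; 16; 17] (Cyc [:: 5;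
  7; 10] (Cyc [:: 13; 17; 18] (Cyc [:: 8; 9; 14] Done))))) (Split 7 (Cyc [::
  5; 7; 10] (Cyc [:: 7; 10; 12] (Cyc [:: 15; 16; 18] (Cyc [:: 8; 9; 14]
  Done)))) (Split 14 (Split 8 (Cyc [:: 8; 9; 14] (Cyc [:: 8; 13; 14] (Cyc [::
  14; 15; 18] Done))) (Cyc [:: 9; 14; 15] (Cyc [:: 13; 14; 18] Done))) (Cyc
  [:: 8; 12; 13] (Cyc [:: 15; 16; 18] Done)))))) (Split 13 (Split 14 (Cyc [::
  8; 13; 14] (Cyc [:: 13; 14; 18] (Cyc [:: 12; 13; 17] (Cyc [:: 5; 6; 11] (Cyc
  [:: 9; 14; 15] Done))))) (Split 12 (Cyc [:: 8; 12; 13] (Cyc [:: 12; 13; 17]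
  (Cyc [:: 5; 6; 11] (Cyc [:: 15; 16; 18] Done)))) (Split 18 (Cyc [:: 13; 17;
  18] (Cyc [:: 15; 16; 18] (Cyc [:: 5; 6; 11] Done))) (Cyc [:: 5; 6; 11] (Cyc
  [:: 8; 9; 15; 16; 17; 13] Done))))) (Cyc [:: 5; 6; 11] (Cyc [:: 7; 8; 12]
  (Cyc [:: 9; 14; 15] (Cyc [:: 16; 17; 18] Done))))).

Definition certA1 : certificate :=
  Split 5 (Cyc [:: 1; 5; 7] (Split 11 (Cyc [:: 5; 6; 11] (Cyc [:: 5; 10; 11]
  (Split 15 (Cyc [:: 9; 11; 15] (Cyc [:: 11; 15; 16] (Cyc [:: 14; 15; 18] (Cyc
  [:: 8; 12; 13] Done)))) (Split 13 (Split 8 (Cyc [:: 8; 12; 13] (Cyc [:: 8;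
  13; 14] (Cyc [:: 13; 17; 18] Done))) (Cyc [:: 12; 13; 17] (Cyc [:: 13; 14;
  18] Done))) (Cyc [:: 8; 9; 14] (Cyc [:: 16; 17; 18] Done)))))) (Split 13
  (Split 18 (Cyc [:: 13; 14; 18] (Cyc [:: 13; 17; 18] (Split 9 (Split 8 (Cyc
  [:: 8; 12; 13] (Cyc [:: 8; 9; 15; 18; 13] (Cyc [:: 5; 6; 9; 8; 13; 18; 16;
  10] Done))) (Split 15 (Cyc [:: 15; 16; 18] (Cyc [:: 5; 6; 9; 15; 18; 13; 12;
  10] Done)) (Cyc [:: 10; 12; 13; 18; 16] Done))) (Cyc [:: 8; 12; 13] (Cyc [::
  15; 16; 18] Done))))) (Split 8 (Cyc [:: 8; 12; 13] (Cyc [:: 8; 13; 14]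
  (Split 10 (Split 16 (Cyc [:: 10; 16; 17] (Cyc [:: 5; 6; 9; 15; 16; 10]
  Done)) (Cyc [:: 5; 6; 9; 8; 13; 17; 10] Done)) (Cyc [:: 8; 9; 15; 16; 17;
  13] Done)))) (Split 17 (Cyc [:: 12; 13; 17] (Cyc [:: 10; 16; 17] (Cyc [:: 9;
  14; 15] Done))) (Split 9 (Split 14 (Cyc [:: 9; 14; 15] (Cyc [:: 5; 6; 9; 14;
  13; 12; 10] Done)) (Cyc [:: 5; 6; 9; 15; 16; 10] Done)) (Cyc [:: 10; 12; 13;
  14; 15; 16] Done))))) (Split 14 (Split 9 (Cyc [:: 8; 9; 14] (Cyc [:: 9; 14;
  15] (Split 10 (Cyc [:: 10; 12; 17] (Cyc [:: 5; 6; 9; 14; 18; 16; 10] Done))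
  (Cyc [:: 16; 17; 18] Done)))) (Split 16 (Split 17 (Cyc [:: 10; 16; 17] (Cyc
  [:: 16; 17; 18] (Cyc [:: 8; 12; 17; 16; 15; 14] Done))) (Split 15 (Cyc [::
  14; 15; 18] (Cyc [:: 8; 12; 10; 16; 15; 14] Done)) (Cyc [:: 8; 12; 10; 16;
  18; 14] Done))) (Cyc [:: 14; 15; 18] (Cyc [:: 10; 12; 17] Done)))) (Split 17
  (Split 10 (Cyc [:: 10; 12; 17] (Cyc [:: 10; 16; 17] (Cyc [:: 5; 6; 9; 15;
  18; 17; 10] Done))) (Split 16 (Cyc [:: 16; 17; 18] (Cyc [:: 8; 9; 15; 16;
  17; 12] Done)) (Cyc [:: 8; 9; 15; 18; 17; 12] Done))) (Cyc [:: 15; 16; 18]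
  (Cyc [:: 5; 6; 9; 8; 12; 10] Done))))))) (Split 13 (Split 17 (Cyc [:: 12;
  13; 17] (Cyc [:: 13; 17; 18] (Split 15 (Split 14 (Cyc [:: 8; 13; 14] (Cyc
  [:: 9; 14; 15] (Cyc [:: 13; 14; 15; 16; 17] (Cyc [:: 10; 11; 15; 14; 13; 17]
  Done)))) (Split 16 (Cyc [:: 10; 16; 17] (Cyc [:: 11; 15; 16] (Cyc [:: 8; 9;
  15; 16; 17; 13] Done))) (Cyc [:: 9; 11; 15] (Cyc [:: 7; 8; 13; 17; 10]
  Done)))) (Cyc [:: 8; 13; 14] (Cyc [:: 10; 16; 17] (Cyc [:: 6; 9; 11]
  Done)))))) (Split 14 (Cyc [:: 8; 13; 14] (Cyc [:: 13; 14; 18] (Split 9 (Cyc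
  [:: 9; 14; 15] (Cyc [:: 6; 9; 11] (Cyc [:: 7; 10; 12] Done))) (Cyc [:: 7;
  10; 12] (Cyc [:: 11; 15; 16] Done))))) (Split 12 (Cyc [:: 8; 12; 13] (Cyc
  [:: 7; 10; 12] (Cyc [:: 6; 9; 11] (Cyc [:: 15; 16; 18] Done)))) (Split 10
  (Split 11 (Cyc [:: 10; 11; 16] (Cyc [:: 6; 9; 11] (Cyc [:: 7; 8; 13; 18; 15;
  11; 10] Done))) (Split 15 (Split 16 (Cyc [:: 15; 16; 18] (Cyc [:: 7; 8; 9;
  15; 16; 10] Done)) (Cyc [:: 8; 9; 15; 18; 13] Done)) (Cyc [:: 7; 8; 13; 18;
  16; 10] Done))) (Cyc [:: 6; 9; 11] (Cyc [:: 15; 16; 18] Done)))))) (Split 15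
  (Split 16 (Cyc [:: 11; 15; 16] (Cyc [:: 15; 16; 18] (Cyc [:: 9; 14; 15] (Cyc
  [:: 10; 16; 17] (Cyc [:: 7; 8; 12] Done))))) (Split 12 (Cyc [:: 7; 8; 12]
  (Cyc [:: 9; 11; 15] (Cyc [:: 10; 12; 17] (Cyc [:: 14; 15; 18] Done))))
  (Split 9 (Cyc [:: 9; 11; 15] (Cyc [:: 9; 14; 15] (Cyc [:: 7; 8; 9; 15; 18;
  17; 10] Done))) (Split 18 (Cyc [:: 14; 15; 18] (Cyc [:: 10; 11; 15; 18; 17]
  Done)) (Cyc [:: 7; 8; 14; 15; 11; 10] Done))))) (Split 10 (Split 12 (Cyc [::
  7; 10; 12] (Cyc [:: 10; 12; 17] (Cyc [:: 10; 11; 16] (Cyc [:: 8; 9; 14]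
  Done)))) (Split 16 (Cyc [:: 10; 11; 16] (Cyc [:: 10; 16; 17] (Cyc [:: 8; 9;
  14] Done))) (Cyc [:: 6; 9; 11] (Cyc [:: 7; 8; 14; 18; 17; 10] Done)))) (Cyc
  [:: 6; 9; 11] (Cyc [:: 7; 8; 12] (Cyc [:: 16; 17; 18] Done)))))).

Definition certA2 : certificate :=
  Split 8 (Cyc [:: 2; 7; 8] (Cyc [:: 2; 8; 9] (Split 13 (Cyc [:: 8; 12; 13]
  (Cyc [:: 8; 13; 14] (Split 17 (Cyc [:: 13; 17; 18] (Cyc [:: 11; 15; 16] (Cyc
  [:: 2; 6; 5; 10; 17; 13; 8] Done))) (Cyc [:: 5; 6; 11] (Cyc [:: 15; 16; 18]
  Done))))) (Split 16 (Split 11 (Cyc [:: 10; 11; 16] (Cyc [:: 11; 15; 16] (Cyc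
  [:: 5; 6; 11] (Cyc [:: 16; 17; 18] Done)))) (Split 17 (Cyc [:: 10; 16; 17]
  (Cyc [:: 16; 17; 18] (Cyc [:: 8; 12; 17; 16; 15; 14] Done))) (Cyc [:: 15;
  16; 18] (Cyc [:: 2; 6; 5; 10; 12; 8] Done)))) (Cyc [:: 5; 6; 11] (Cyc [::
  10; 12; 17] (Cyc [:: 14; 15; 18] Done))))))) (Split 6 (Cyc [:: 2; 6; 9]
  (Split 5 (Cyc [:: 2; 6; 5; 7] (Cyc [:: 5; 6; 11] (Split 17 (Cyc [:: 14; 15;
  18] (Cyc [:: 12; 13; 17] (Cyc [:: 10; 16; 17] Done))) (Split 18 (Cyc [:: 13;
  14; 18] (Cyc [:: 15; 16; 18] Done)) (Cyc [:: 10; 12; 13; 14; 15; 16]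
  Done))))) (Split 16 (Split 17 (Cyc [:: 10; 16; 17] (Cyc [:: 16; 17; 18] (Cyc
  [:: 2; 6; 11; 16; 17; 12; 7] (Cyc [:: 13; 14; 15; 16; 17] Done)))) (Cyc [::
  7; 10; 12] (Cyc [:: 11; 15; 16] (Cyc [:: 13; 14; 18] Done)))) (Cyc [:: 2; 6;
  11; 10; 7] (Cyc [:: 12; 13; 17] (Cyc [:: 14; 15; 18] Done)))))) (Split 10
  (Split 16 (Cyc [:: 10; 11; 16] (Cyc [:: 10; 16; 17] (Cyc [:: 5; 7; 10] (Cyc
  [:: 9; 14; 15] (Cyc [:: 10; 12; 13; 18; 16] Done))))) (Cyc [:: 5; 7; 10]
  (Cyc [:: 10; 12; 17] (Cyc [:: 9; 11; 15] (Cyc [:: 13; 14; 18] Done)))))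
  (Split 18 (Split 15 (Cyc [:: 14; 15; 18] (Cyc [:: 15; 16; 18] (Cyc [:: 9;
  11; 15] (Cyc [:: 13; 17; 18] Done)))) (Cyc [:: 13; 14; 18] (Cyc [:: 16; 17;
  18] (Cyc [:: 2; 7; 5; 11; 9] Done)))) (Split 9 (Cyc [:: 9; 14; 15] (Cyc [::
  2; 7; 5; 11; 9] (Cyc [:: 12; 13; 17] Done))) (Cyc [:: 11; 15; 16] (Cyc [::
  12; 13; 17] Done)))))).

Definition certA0 : certificate :=
  Split 5 (Cyc [:: 0; 5; 6] (Split 10 (Cyc [:: 5; 7; 10] (Cyc [:: 5; 10; 11]
  (Split 17 (Cyc [:: 10; 12; 17] (Cyc [:: 10; 16; 17] (Cyc [:: 13; 17; 18]
  (Cyc [:: 8; 9; 14] Done)))) (Split 14 (Split 8 (Cyc [:: 8; 9; 14] (Cyc [::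
  8; 13; 14] (Cyc [:: 14; 15; 18] Done))) (Cyc [:: 9; 14; 15] (Cyc [:: 13; 14;
  18] Done))) (Cyc [:: 8; 12; 13] (Cyc [:: 15; 16; 18] Done)))))) (Split 18
  (Split 15 (Cyc [:: 14; 15; 18] (Cyc [:: 15; 16; 18] (Cyc [:: 9; 11; 15] (Cyc
  [:: 13; 17; 18] (Cyc [:: 7; 8; 12] Done))))) (Split 13 (Cyc [:: 13; 14; 18]
  (Cyc [:: 13; 17; 18] (Split 8 (Cyc [:: 8; 12; 13] (Cyc [:: 5; 7; 8; 9; 11]
  Done)) (Cyc [:: 5; 7; 12; 13; 18; 16; 11] Done)))) (Split 16 (Cyc [:: 16;
  17; 18] (Cyc [:: 7; 8; 12] (Cyc [:: 9; 11; 16; 18; 14] Done))) (Split 8 (Cyc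
  [:: 5; 7; 8; 9; 11] (Cyc [:: 8; 12; 17; 18; 14] Done)) (Cyc [:: 5; 7; 12;
  17; 18; 14; 9; 11] Done))))) (Split 8 (Split 12 (Cyc [:: 7; 8; 12] (Cyc [::
  8; 12; 13] (Cyc [:: 8; 9; 14] (Cyc [:: 11; 15; 16] Done)))) (Split 14 (Cyc
  [:: 8; 9; 14] (Cyc [:: 8; 13; 14] (Cyc [:: 5; 7; 8; 14; 15; 11] Done)))
  (Split 11 (Cyc [:: 5; 7; 8; 9; 11] (Cyc [:: 11; 15; 16] Done)) (Cyc [:: 8;
  9; 15; 16; 17; 13] Done)))) (Split 15 (Cyc [:: 9; 14; 15] (Cyc [:: 11; 15;
  16] (Cyc [:: 12; 13; 17] Done))) (Split 12 (Split 17 (Cyc [:: 12; 13; 17]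
  (Cyc [:: 5; 7; 12; 17; 16; 11] Done)) (Cyc [:: 5; 7; 12; 13; 14; 9; 11]
  Done)) (Cyc [:: 9; 11; 16; 17; 13; 14] Done))))))) (Split 13 (Split 17 (Cyc
  [:: 12; 13; 17] (Cyc [:: 13; 17; 18] (Split 15 (Split 14 (Cyc [:: 8; 13; 14]
  (Cyc [:: 9; 14; 15] (Cyc [:: 13; 14; 15; 16; 17] (Cyc [:: 10; 11; 15; 14;
  13; 17] Done)))) (Split 16 (Cyc [:: 10; 16; 17] (Cyc [:: 11; 15; 16] (Cyc
  [:: 8; 9; 15; 16; 17; 13] Done))) (Cyc [:: 9; 11; 15] (Cyc [:: 7; 8; 13; 17;
  10] Done)))) (Cyc [:: 8; 13; 14] (Cyc [:: 10; 16; 17] (Cyc [:: 6; 9; 11]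
  Done)))))) (Split 14 (Cyc [:: 8; 13; 14] (Cyc [:: 13; 14; 18] (Split 9 (Cyc
  [:: 9; 14; 15] (Cyc [:: 6; 9; 11] (Cyc [:: 7; 10; 12] Done))) (Cyc [:: 7;
  10; 12] (Cyc [:: 11; 15; 16] Done))))) (Split 12 (Cyc [:: 8; 12; 13] (Cyc
  [:: 7; 10; 12] (Cyc [:: 6; 9; 11] (Cyc [:: 15; 16; 18] Done)))) (Split 10
  (Split 11 (Cyc [:: 10; 11; 16] (Cyc [:: 6; 9; 11] (Cyc [:: 7; 8; 13; 18; 15;
  11; 10] Done))) (Split 15 (Split 16 (Cyc [:: 15; 16; 18] (Cyc [:: 7; 8; 9;
  15; 16; 10] Done)) (Cyc [:: 8; 9; 15; 18; 13] Done)) (Cyc [:: 7; 8; 13; 18;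
  16; 10] Done))) (Cyc [:: 6; 9; 11] (Cyc [:: 15; 16; 18] Done)))))) (Split 15
  (Split 16 (Cyc [:: 11; 15; 16] (Cyc [:: 15; 16; 18] (Cyc [:: 9; 14; 15] (Cyc
  [:: 10; 16; 17] (Cyc [:: 7; 8; 12] Done))))) (Split 12 (Cyc [:: 7; 8; 12]
  (Cyc [:: 9; 11; 15] (Cyc [:: 10; 12; 17] (Cyc [:: 14; 15; 18] Done))))
  (Split 9 (Cyc [:: 9; 11; 15] (Cyc [:: 9; 14; 15] (Cyc [:: 7; 8; 9; 15; 18;
  17; 10] Done))) (Split 18 (Cyc [:: 14; 15; 18] (Cyc [:: 10; 11; 15; 18; 17]
  Done)) (Cyc [:: 7; 8; 14; 15; 11; 10] Done))))) (Split 10 (Split 12 (Cyc [::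
  7; 10; 12] (Cyc [:: 10; 12; 17] (Cyc [:: 10; 11; 16] (Cyc [:: 8; 9; 14]
  Done)))) (Split 16 (Cyc [:: 10; 11; 16] (Cyc [:: 10; 16; 17] (Cyc [:: 8; 9;
  14] Done))) (Cyc [:: 6; 9; 11] (Cyc [:: 7; 8; 14; 18; 17; 10] Done)))) (Cyc
  [:: 6; 9; 11] (Cyc [:: 7; 8; 12] (Cyc [:: 16; 17; 18] Done)))))).

Definition certA12 : certificate :=
  Cyc [:: 1; 2; 7] (Split 9 (Cyc [:: 2; 6; 9] (Cyc [:: 2; 8; 9] (Split 15 (Cyc
  [:: 9; 11; 15] (Cyc [:: 9; 14; 15] (Split 16 (Cyc [:: 15; 16; 18] (Cyc [::
  1; 2; 9; 15; 16; 10; 5] (Cyc [:: 12; 13; 17] Done))) (Split 17 (Cyc [:: 1;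
  2; 9; 15; 18; 17; 10; 5] (Cyc [:: 12; 13; 17] Done)) (Cyc [:: 1; 2; 9; 15;
  18; 13; 12; 10; 5] Done))))) (Split 16 (Split 11 (Cyc [:: 1; 2; 9; 11; 5]
  (Cyc [:: 10; 11; 16] (Cyc [:: 12; 13; 17] (Cyc [:: 9; 11; 16; 18; 14]
  Done)))) (Split 17 (Cyc [:: 10; 16; 17] (Cyc [:: 16; 17; 18] (Cyc [:: 12;
  13; 17] Done))) (Split 13 (Split 14 (Cyc [:: 13; 14; 18] (Cyc [:: 1; 2; 9;
  14; 13; 12; 10; 5] Done)) (Cyc [:: 10; 12; 13; 18; 16] Done)) (Cyc [:: 1; 2;
  9; 14; 18; 16; 10; 5] Done)))) (Cyc [:: 1; 2; 9; 11; 5] (Cyc [:: 10; 12; 17]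
  (Cyc [:: 13; 14; 18] Done))))))) (Split 17 (Split 18 (Cyc [:: 13; 17; 18]
  (Cyc [:: 16; 17; 18] (Split 10 (Cyc [:: 10; 12; 17] (Split 11 (Cyc [:: 5;
  10; 11] (Cyc [:: 10; 11; 15; 18; 17] (Cyc [:: 2; 6; 11; 10; 17; 18; 14; 8]
  Done))) (Cyc [:: 1; 2; 6; 5] (Cyc [:: 14; 15; 18] Done)))) (Split 14 (Cyc
  [:: 14; 15; 18] (Cyc [:: 1; 2; 6; 5] (Cyc [:: 8; 12; 17; 18; 14] Done)))
  (Split 5 (Cyc [:: 1; 2; 6; 5] (Cyc [:: 1; 2; 8; 12; 17; 18; 15; 11; 5]
  Done)) (Cyc [:: 2; 6; 11; 15; 18; 17; 12; 8] Done)))))) (Split 10 (Cyc [::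
  10; 12; 17] (Cyc [:: 10; 16; 17] (Split 5 (Cyc [:: 1; 2; 6; 5] (Cyc [:: 5;
  10; 11] (Cyc [:: 1; 2; 8; 13; 17; 10; 5] Done))) (Split 8 (Split 14 (Cyc [::
  8; 13; 14] (Cyc [:: 2; 6; 11; 15; 14; 8] Done)) (Cyc [:: 2; 6; 11; 10; 17;
  13; 8] Done)) (Cyc [:: 10; 11; 15; 14; 13; 17] Done))))) (Split 13 (Cyc [::
  12; 13; 17] (Cyc [:: 1; 2; 6; 5] (Cyc [:: 8; 13; 14] (Cyc [:: 11; 15; 16]
  Done)))) (Split 5 (Cyc [:: 1; 2; 6; 5] (Split 11 (Split 15 (Cyc [:: 11; 15;
  16] (Cyc [:: 1; 2; 8; 14; 15; 11; 5] Done)) (Cyc [:: 1; 2; 8; 12; 17; 16;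
  11; 5] Done)) (Cyc [:: 8; 12; 17; 16; 15; 14] Done))) (Split 11 (Split 15
  (Cyc [:: 11; 15; 16] (Cyc [:: 2; 6; 11; 15; 14; 8] Done)) (Cyc [:: 2; 6; 11;
  16; 17; 12; 8] Done)) (Cyc [:: 8; 12; 17; 16; 15; 14] Done)))))) (Split 5
  (Cyc [:: 1; 2; 6; 5] (Split 14 (Split 13 (Cyc [:: 8; 13; 14] (Cyc [:: 13;
  14; 18] (Split 10 (Cyc [:: 5; 10; 11] (Cyc [:: 10; 12; 13; 14; 15; 16]
  Done)) (Cyc [:: 11; 15; 16] Done)))) (Split 11 (Cyc [:: 5; 10; 11] (Split 15
  (Cyc [:: 1; 2; 8; 14; 15; 11; 5] (Cyc [:: 11; 15; 16] Done)) (Cyc [:: 1; 2;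
  8; 14; 18; 16; 11; 5] Done))) (Cyc [:: 14; 15; 18] (Cyc [:: 1; 2; 8; 12; 10;
  5] Done)))) (Cyc [:: 8; 12; 13] (Cyc [:: 5; 10; 11] (Cyc [:: 15; 16; 18]
  Done))))) (Split 13 (Split 8 (Cyc [:: 8; 12; 13] (Cyc [:: 8; 13; 14] (Split
  11 (Cyc [:: 10; 11; 16] (Cyc [:: 2; 6; 11; 15; 18; 13; 8] Done)) (Cyc [::
  15; 16; 18] Done)))) (Split 15 (Split 16 (Cyc [:: 11; 15; 16] (Cyc [:: 15;
  16; 18] (Cyc [:: 10; 12; 13; 14; 15; 16] Done))) (Split 14 (Cyc [:: 13; 14;
  18] (Cyc [:: 10; 11; 15; 14; 13; 12] Done)) (Cyc [:: 10; 11; 15; 18; 13; 12]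
  Done))) (Cyc [:: 13; 14; 18] (Cyc [:: 10; 11; 16] Done)))) (Split 16 (Split
  11 (Cyc [:: 10; 11; 16] (Cyc [:: 11; 15; 16] (Cyc [:: 2; 6; 11; 16; 18; 14;
  8] Done))) (Split 15 (Cyc [:: 15; 16; 18] (Cyc [:: 8; 12; 10; 16; 15; 14]
  Done)) (Cyc [:: 8; 12; 10; 16; 18; 14] Done))) (Cyc [:: 14; 15; 18] (Cyc [::
  2; 6; 11; 10; 12; 8] Done))))))).

Definition certA02 : certificate :=
  Cyc [:: 0; 2; 6] (Split 8 (Cyc [:: 2; 7; 8] (Cyc [:: 2; 8; 9] (Split 12 (Cyc
  [:: 8; 12; 13] (Split 10 (Cyc [:: 0; 2; 8; 12; 10; 5] (Cyc [:: 10; 12; 17]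
  (Cyc [:: 10; 11; 16] (Cyc [:: 14; 15; 18] Done)))) (Split 18 (Split 14 (Cyc
  [:: 14; 15; 18] (Cyc [:: 8; 12; 17; 18; 14] (Cyc [:: 0; 2; 8; 14; 18; 16;
  11; 5] Done))) (Split 15 (Cyc [:: 15; 16; 18] (Cyc [:: 0; 2; 8; 12; 17; 18;
  15; 11; 5] Done)) (Cyc [:: 16; 17; 18] Done))) (Split 11 (Split 15 (Cyc [::
  11; 15; 16] (Cyc [:: 0; 2; 8; 14; 15; 11; 5] Done)) (Cyc [:: 0; 2; 8; 12;
  17; 16; 11; 5] Done)) (Cyc [:: 8; 12; 17; 16; 15; 14] Done))))) (Split 15
  (Split 14 (Cyc [:: 8; 13; 14] (Cyc [:: 14; 15; 18] (Cyc [:: 10; 16; 17] (Cyc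
  [:: 0; 2; 8; 14; 15; 11; 5] Done)))) (Split 16 (Cyc [:: 11; 15; 16] (Cyc [::
  15; 16; 18] (Cyc [:: 10; 16; 17] Done))) (Cyc [:: 5; 10; 11] (Cyc [:: 13;
  17; 18] Done)))) (Cyc [:: 8; 13; 14] (Cyc [:: 5; 10; 11] (Cyc [:: 16; 17;
  18] Done))))))) (Split 16 (Split 18 (Cyc [:: 15; 16; 18] (Cyc [:: 16; 17;
  18] (Split 9 (Split 11 (Cyc [:: 0; 2; 9; 11; 5] (Cyc [:: 10; 11; 16] (Cyc
  [:: 9; 11; 16; 18; 14] (Cyc [:: 2; 7; 12; 13; 18; 16; 11; 9] Done)))) (Split
  7 (Cyc [:: 0; 2; 7; 5] (Cyc [:: 7; 10; 12] (Cyc [:: 13; 14; 18] Done)))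
  (Split 13 (Cyc [:: 13; 14; 18] (Cyc [:: 10; 12; 13; 18; 16] Done)) (Cyc [::
  0; 2; 9; 14; 18; 16; 10; 5] Done)))) (Cyc [:: 0; 2; 7; 5] (Cyc [:: 10; 11;
  16] (Cyc [:: 13; 14; 18] Done)))))) (Split 10 (Cyc [:: 10; 11; 16] (Cyc [::
  10; 16; 17] (Split 7 (Cyc [:: 5; 7; 10] (Cyc [:: 7; 10; 12] (Cyc [:: 2; 7;
  10; 16; 15; 9] Done))) (Split 15 (Cyc [:: 0; 2; 9; 15; 16; 10; 5] (Cyc [::
  10; 12; 13; 14; 15; 16] Done)) (Cyc [:: 0; 2; 9; 14; 13; 12; 10; 5]
  Done))))) (Split 11 (Cyc [:: 11; 15; 16] (Split 5 (Cyc [:: 0; 2; 7; 5] (Cyc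
  [:: 0; 2; 9; 11; 5] (Cyc [:: 12; 13; 17] Done))) (Split 12 (Split 13 (Cyc
  [:: 12; 13; 17] (Cyc [:: 2; 7; 12; 13; 14; 9] Done)) (Cyc [:: 2; 7; 12; 17;
  16; 11; 9] Done)) (Cyc [:: 9; 11; 16; 17; 13; 14] Done)))) (Cyc [:: 0; 2; 7;
  5] (Cyc [:: 9; 14; 15] (Cyc [:: 12; 13; 17] Done)))))) (Split 5 (Cyc [:: 0;
  2; 7; 5] (Split 11 (Cyc [:: 0; 2; 9; 11; 5] (Cyc [:: 5; 10; 11] (Cyc [:: 12;
  13; 17] (Cyc [:: 14; 15; 18] Done)))) (Split 14 (Cyc [:: 9; 14; 15] (Cyc [::
  13; 14; 18] (Cyc [:: 10; 12; 17] Done))) (Split 17 (Cyc [:: 10; 12; 17] (Cyc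
  [:: 13; 17; 18] Done)) (Cyc [:: 0; 2; 9; 15; 18; 13; 12; 10; 5] Done)))))
  (Split 14 (Split 17 (Split 12 (Cyc [:: 10; 12; 17] (Cyc [:: 12; 13; 17]
  (Split 15 (Cyc [:: 9; 14; 15] (Cyc [:: 14; 15; 18] Done)) (Cyc [:: 2; 7; 12;
  17; 18; 14; 9] Done)))) (Split 15 (Cyc [:: 9; 14; 15] (Cyc [:: 14; 15; 18]
  (Cyc [:: 10; 11; 15; 14; 13; 17] Done))) (Cyc [:: 13; 14; 18] (Cyc [:: 2; 7;
  10; 11; 9] Done)))) (Cyc [:: 9; 14; 15] (Cyc [:: 13; 14; 18] (Cyc [:: 7; 10;
  12] Done)))) (Cyc [:: 7; 10; 12] (Cyc [:: 9; 11; 15] (Cyc [:: 13; 17; 18]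
  Done))))))).

Definition certB : certificate :=
  Split 24 (Split 25 (Cyc [:: 19; 24; 25] (Cyc [:: 24; 25; 30] (Cyc [:: 20;
  24; 26] (Cyc [:: 23; 25; 29] (Cyc [:: 21; 22; 27] Done))))) (Split 26 (Cyc
  [:: 20; 24; 26] (Cyc [:: 24; 26; 30] (Cyc [:: 22; 26; 28] (Cyc [:: 21; 23;
  27] Done)))) (Cyc [:: 19; 20; 24] (Cyc [:: 28; 29; 30] (Cyc [:: 21; 22; 27]
  Done))))) (Split 27 (Split 28 (Cyc [:: 22; 27; 28] (Cyc [:: 27; 28; 29] (Cyc
  [:: 21; 23; 27] (Cyc [:: 26; 28; 30] Done)))) (Cyc [:: 20; 22; 26] (Cyc [::
  21; 23; 27] (Cyc [:: 25; 29; 30] Done)))) (Cyc [:: 19; 23; 25] (Cyc [:: 20;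
  22; 26] (Cyc [:: 28; 29; 30] Done)))).

Definition certB3 : certificate :=
  Split 22 (Cyc [:: 3; 20; 22] (Cyc [:: 3; 21; 22] (Split 28 (Cyc [:: 22; 26;
  28] (Cyc [:: 22; 27; 28] (Cyc [:: 28; 29; 30] (Cyc [:: 19; 23; 25] Done))))
  (Split 25 (Split 19 (Cyc [:: 19; 23; 25] (Cyc [:: 19; 24; 25] (Cyc [:: 25;
  29; 30] Done))) (Cyc [:: 23; 25; 29] (Cyc [:: 24; 25; 30] Done))) (Cyc [::
  23; 27; 29] (Cyc [:: 24; 26; 30] Done)))))) (Split 24 (Split 30 (Cyc [:: 24;
  25; 30] (Cyc [:: 24; 26; 30] (Cyc [:: 19; 20; 24] (Cyc [:: 28; 29; 30] (Cyc
  [:: 21; 23; 27] Done))))) (Split 20 (Cyc [:: 19; 20; 24] (Cyc [:: 20; 24;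
  26] (Cyc [:: 27; 28; 29] (Cyc [:: 3; 20; 24; 25; 23; 21] Done)))) (Split 25
  (Cyc [:: 19; 24; 25] (Cyc [:: 21; 23; 27] (Cyc [:: 24; 25; 29; 28; 26]
  Done))) (Split 27 (Cyc [:: 21; 23; 27] (Cyc [:: 27; 28; 29] Done)) (Cyc [::
  19; 23; 29; 28; 26; 24] Done))))) (Split 29 (Split 23 (Cyc [:: 23; 25; 29]
  (Cyc [:: 23; 27; 29] (Cyc [:: 28; 29; 30] (Cyc [:: 3; 20; 19; 23; 21]
  Done)))) (Split 28 (Cyc [:: 27; 28; 29] (Cyc [:: 28; 29; 30] (Cyc [:: 19;
  20; 26; 28; 29; 25] Done))) (Split 25 (Cyc [:: 25; 29; 30] (Cyc [:: 3; 20;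
  19; 25; 29; 27; 21] Done)) (Cyc [:: 3; 20; 26; 30; 29; 27; 21] Done))))
  (Split 23 (Cyc [:: 19; 23; 25] (Cyc [:: 21; 23; 27] (Cyc [:: 26; 28; 30]
  Done))) (Split 26 (Split 28 (Cyc [:: 26; 28; 30] (Cyc [:: 3; 20; 26; 28; 27;
  21] Done)) (Cyc [:: 19; 20; 26; 30; 25] Done)) (Cyc [:: 3; 20; 19; 25; 30;
  28; 27; 21] Done))))).

Definition certB4 : certificate :=
  Split 23 (Cyc [:: 4; 19; 23] (Cyc [:: 4; 21; 23] (Split 29 (Cyc [:: 23; 25;
  29] (Cyc [:: 23; 27; 29] (Cyc [:: 28; 29; 30] (Cyc [:: 20; 22; 26] Done))))
  (Split 26 (Split 20 (Cyc [:: 20; 22; 26] (Cyc [:: 20; 24; 26] (Cyc [:: 26;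
  28; 30] Done))) (Cyc [:: 22; 26; 28] (Cyc [:: 24; 26; 30] Done))) (Cyc [::
  22; 27; 28] (Cyc [:: 24; 25; 30] Done)))))) (Split 24 (Split 30 (Cyc [:: 24;
  25; 30] (Cyc [:: 24; 26; 30] (Cyc [:: 19; 20; 24] (Cyc [:: 28; 29; 30] (Cyc
  [:: 21; 22; 27] Done))))) (Split 19 (Cyc [:: 19; 20; 24] (Cyc [:: 19; 24;
  25] (Cyc [:: 27; 28; 29] (Cyc [:: 4; 19; 24; 26; 22; 21] Done)))) (Split 26
  (Cyc [:: 20; 24; 26] (Cyc [:: 21; 22; 27] (Cyc [:: 24; 25; 29; 28; 26]
  Done))) (Split 27 (Cyc [:: 21; 22; 27] (Cyc [:: 27; 28; 29] Done)) (Cyc [::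
  20; 22; 28; 29; 25; 24] Done))))) (Split 28 (Split 22 (Cyc [:: 22; 26; 28]
  (Cyc [:: 22; 27; 28] (Cyc [:: 28; 29; 30] (Cyc [:: 4; 19; 20; 22; 21]
  Done)))) (Split 29 (Cyc [:: 27; 28; 29] (Cyc [:: 28; 29; 30] (Cyc [:: 19;
  20; 26; 28; 29; 25] Done))) (Split 26 (Cyc [:: 26; 28; 30] (Cyc [:: 4; 19;
  20; 26; 28; 27; 21] Done)) (Cyc [:: 4; 19; 25; 30; 28; 27; 21] Done))))
  (Split 22 (Cyc [:: 20; 22; 26] (Cyc [:: 21; 22; 27] (Cyc [:: 25; 29; 30]
  Done))) (Split 25 (Split 29 (Cyc [:: 25; 29; 30] (Cyc [:: 4; 19; 25; 29; 27;
  21] Done)) (Cyc [:: 19; 20; 26; 30; 25] Done)) (Cyc [:: 4; 19; 20; 26; 30;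
  29; 27; 21] Done))))).

Definition certB0 : certificate :=
  Split 28 (Split 29 (Cyc [:: 27; 28; 29] (Cyc [:: 28; 29; 30] (Split 24
  (Split 25 (Cyc [:: 19; 24; 25] (Cyc [:: 23; 25; 29] (Cyc [:: 24; 25; 29; 28;
  26] (Cyc [:: 20; 22; 28; 29; 25; 24] Done)))) (Split 26 (Cyc [:: 20; 24; 26]
  (Cyc [:: 22; 26; 28] (Cyc [:: 19; 23; 29; 28; 26; 24] Done))) (Cyc [:: 0;
  19; 20] (Cyc [:: 21; 22; 28; 29; 23] Done)))) (Cyc [:: 0; 19; 20] (Cyc [::
  23; 25; 29] (Cyc [:: 22; 26; 28] Done)))))) (Split 26 (Cyc [:: 22; 26; 28]
  (Cyc [:: 26; 28; 30] (Split 20 (Cyc [:: 0; 19; 20] (Cyc [:: 20; 24; 26] (Cyc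
  [:: 21; 23; 27] Done))) (Cyc [:: 19; 24; 25] (Cyc [:: 21; 23; 27] Done)))))
  (Split 27 (Cyc [:: 22; 27; 28] (Cyc [:: 0; 19; 20] (Cyc [:: 21; 23; 27] (Cyc
  [:: 24; 25; 30] Done)))) (Split 23 (Split 19 (Cyc [:: 0; 19; 20] (Cyc [::
  19; 23; 25] (Cyc [:: 19; 23; 21; 22; 28; 30; 24] Done))) (Split 24 (Split 25
  (Cyc [:: 24; 25; 30] (Cyc [:: 20; 22; 21; 23; 25; 24] Done)) (Cyc [:: 20;
  22; 28; 30; 24] Done)) (Cyc [:: 21; 22; 28; 30; 25; 23] Done))) (Cyc [:: 0;
  19; 20] (Cyc [:: 24; 25; 30] Done)))))) (Split 19 (Cyc [:: 0; 19; 20] (Split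
  25 (Cyc [:: 19; 23; 25] (Cyc [:: 19; 24; 25] (Cyc [:: 25; 29; 30] (Cyc [::
  21; 22; 27] Done)))) (Split 27 (Cyc [:: 21; 22; 27] (Cyc [:: 23; 27; 29]
  (Cyc [:: 24; 26; 30] Done))) (Split 24 (Split 26 (Cyc [:: 24; 26; 30] (Cyc
  [:: 19; 23; 21; 22; 26; 24] Done)) (Cyc [:: 19; 23; 29; 30; 24] Done)) (Cyc
  [:: 21; 22; 26; 30; 29; 23] Done))))) (Split 24 (Split 26 (Cyc [:: 20; 24;
  26] (Cyc [:: 24; 26; 30] (Cyc [:: 21; 22; 27] (Cyc [:: 23; 25; 29] Done))))
  (Split 25 (Cyc [:: 24; 25; 30] (Cyc [:: 23; 25; 29] (Cyc [:: 21; 22; 27]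
  Done))) (Split 27 (Cyc [:: 21; 22; 27] (Cyc [:: 23; 27; 29] Done)) (Cyc [::
  20; 22; 21; 23; 29; 30; 24] Done)))) (Cyc [:: 20; 22; 26] (Cyc [:: 21; 23;
  27] (Cyc [:: 25; 29; 30] Done))))).

Definition certB34 : certificate :=
  Cyc [:: 3; 4; 21] (Split 19 (Cyc [:: 3; 4; 19; 20] (Cyc [:: 4; 19; 23]
  (Split 24 (Cyc [:: 19; 24; 25] (Split 26 (Cyc [:: 3; 4; 19; 24; 26; 22] (Cyc
  [:: 24; 26; 30] (Cyc [:: 27; 28; 29] Done))) (Split 28 (Cyc [:: 22; 27; 28]
  (Cyc [:: 28; 29; 30] Done)) (Cyc [:: 3; 4; 19; 24; 30; 29; 27; 22] Done))))
  (Split 28 (Split 22 (Cyc [:: 22; 26; 28] (Cyc [:: 22; 27; 28] (Cyc [:: 3; 4;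
  19; 25; 29; 28; 22] Done))) (Cyc [:: 27; 28; 29] (Cyc [:: 26; 28; 30]
  Done))) (Split 25 (Split 29 (Cyc [:: 25; 29; 30] (Cyc [:: 3; 4; 19; 25; 29;
  27; 22] Done)) (Cyc [:: 3; 4; 19; 25; 30; 26; 22] Done)) (Cyc [:: 22; 26;
  30; 29; 27] Done)))))) (Split 22 (Cyc [:: 3; 20; 22] (Split 28 (Cyc [:: 22;
  26; 28] (Cyc [:: 22; 27; 28] (Cyc [:: 24; 25; 30] (Cyc [:: 3; 4; 23; 29; 28;
  22] Done)))) (Split 23 (Cyc [:: 3; 4; 23; 27; 22] (Cyc [:: 23; 25; 29] (Cyc
  [:: 24; 26; 30] Done))) (Split 30 (Cyc [:: 22; 26; 30; 29; 27] (Cyc [:: 24;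
  25; 30] Done)) (Cyc [:: 22; 26; 24; 25; 29; 27] Done))))) (Split 30 (Split
  29 (Cyc [:: 25; 29; 30] (Cyc [:: 28; 29; 30] (Cyc [:: 23; 27; 29] (Cyc [::
  24; 26; 30] Done)))) (Split 26 (Cyc [:: 24; 26; 30] (Cyc [:: 26; 28; 30]
  (Cyc [:: 3; 4; 23; 25; 30; 26; 20] Done))) (Split 25 (Cyc [:: 24; 25; 30]
  (Cyc [:: 23; 25; 30; 28; 27] Done)) (Cyc [:: 3; 4; 23; 27; 28; 30; 24; 20]
  Done)))) (Split 29 (Cyc [:: 23; 25; 29] (Cyc [:: 27; 28; 29] (Cyc [:: 20;
  24; 26] Done))) (Split 20 (Split 26 (Cyc [:: 20; 24; 26] (Cyc [:: 3; 4; 23;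
  27; 28; 26; 20] Done)) (Cyc [:: 3; 4; 23; 25; 24; 20] Done)) (Cyc [:: 23;
  25; 24; 26; 28; 27] Done)))))).

(** The pairs 0 1, 0 3 and 0 4 get no tree of their own: when one of them is avoided, the triangles
    force so many of the other vertices among 0, ..., 4 to be hit that the bounds for smaller
    avoided sets suffice. *)
Lemma check_certs :
  [&& check [::] (iota 5 14) 6 certA, check [:: 0]%N (iota 5 14) 7 certA0,
      check [:: 1]%N (iota 5 14) 7 certA1, check [:: 2] (iota 5 14) 7 certA2,
      check [:: 0; 2]%N (iota 5 14) 8 certA02,
      check [:: 1; 2]%N (iota 5 14) 8 certA12,
      check [::] (iota 19 12) 5 certB, check [:: 0]%N (iota 19 12) 6 certB0,
      check [:: 3] (iota 19 12) 6 certB3, check [:: 4] (iota 19 12) 6 certB4 &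
      check [:: 3; 4] (iota 19 12) 7 certB34].
Proof. by lazy. Qed.

(** * The triangulation as a relation, and the bound 16 on its hitting sets *)

Lemma badj_lt x y : badj x y -> (x < 31)%N.
Proof.
rewrite /badj; case: (ltnP x (size neighbours)) => // lx.
by rewrite nth_default.
Qed.

Lemma badj_sym : symmetric badj.
Proof.
have /allP sym :
    all (fun x => all (badj^~ x) (nth [::] neighbours x)) (iota 0 31).
  by lazy.
have symW x y : badj x y -> badj y x.
  move=> xy; have := sym x; rewrite mem_iota /= (badj_lt xy) => /(_ isT) /allP.
  exact.
by move=> x y; apply/idP/idP; apply: symW.
Qed.

Lemma badj_irrefl : irreflexive badj.
Proof.
move=> x; apply/negP => xx.
have /allP irr : all (fun x => ~~ badj x x) (iota 0 31) by lazy.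
by have := irr x; rewrite mem_iota (badj_lt xx) xx => /(_ isT).
Qed.

Lemma hits_cycles_count (S : pred nat) :
  hits_cycles S -> (16 <= count S (iota 0 31))%N.
Proof.
move=> hS.
have tri x y z : ucycleb badj [:: x; y; z] -> [|| S x, S y | S z].
  by move=> c; have := hS [:: x; y; z] isT c; rewrite /= orbF.
(* These seven are the triangles of the two complete graphs; they restrict which of 0, ..., 4 can be
   avoided together. *)
have t012 := tri 0%N 1%N 2 isT.
have t013 := tri 0%N 1%N 3 isT.
have t023 := tri 0%N 2 3 isT.
have t123 := tri 1%N 2 3 isT.
have t034 := tri 0%N 3 4 isT.
have t014 := tri 0%N 1%N 4 isT.
have t134 := tri 1%N 3 4 isT.
have {tri} bound t I U k : check I U k t -> ~~ has S I -> (k <= count S U)%N.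
  exact: check_sound.
have /and5P[/bound a0 /bound a1 /bound a2 /bound a3] := check_certs.
case/and5P=> /bound a4 /bound a5 /bound b0 /bound b1.
case/and3P=> /bound b2 /bound b3 /bound b4.
rewrite [iota 0 31](_ : _ = iota 0 5 ++ iota 5 14 ++ iota 19 12) // !count_cat.
move: (count S (iota 5 14)) (count S (iota 19 12))
  a0 a1 a2 a3 a4 a5 b0 b1 b2 b3 b4.
move=> m n; move: t012 t013 t023 t123 t034 t014 t134; rewrite /= !orbF.
(* All 32 states: either some triangle is avoided, or the hit vertices among 0, ..., 4 and the
   bounds on [m] and [n] add up to 16, such as 5 + 6 + 5 with nothing avoided or 3 + 7 + 6 with 0
   and 1 avoided. *)
by case: (S 0%N) (S 1%N) (S 2) (S 3) (S 4) => [] [] [] [] [] //=; lia.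
Qed.

(** * Cycles in induced subgraphs, and a criterion for acyclicity *)

Lemma acyclic_hits (G : sgraph) (F : {set G}) (c : seq G) :
  acyclic (induced_subgraph F) -> (2 < size c)%N -> ucycle (@adj G) c ->
  has [pred x | x \notin F] c.
Proof.
move=> acF sc /andP[cc uc]; apply/negPn/negP; rewrite has_predC negbK => cF.
(* A cycle staying inside [F] lifts to the subtype, where it contradicts acyclicity. *)
have [s Es] := all_sigP cF; rewrite {c cF}Es size_map in sc cc uc *.
apply: (acF s sc); apply/andP; split; last exact: map_uniq uc.
by rewrite cycle_map in cc.
Qed.

(* The vertex of least rank on a cycle has two cycle neighbours of higher
   rank. *)
Lemma rank_acyclic (G : sgraph) (r : G -> nat) :
  (forall x y z, adj x y -> adj x z -> (r x <= r y)%N -> (r x <= r z)%N ->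
     y = z) ->
  acyclic G.
Proof.
move=> rP c sc /andP[cc uc].
have [x0 x0c] : exists x, x \in c.
  by case: c sc {cc uc} => // x c _; exists x; rewrite mem_head.
case: (arg_minnP r x0c) => x xc xmin.
have [i s Es] := rot_to xc.
have mins y : y \in s -> (r x <= r y)%N.
  move=> ys; apply: xmin; have : y \in rot i c by rewrite Es inE ys orbT.
  by rewrite mem_rot.
(* Rotated to start at [x], the cycle has the neighbours of [x] as its second and last entries;
   these are distinct because the length is at least 3. *)
rewrite -(size_rot i) -(rot_cycle i) -(rot_uniq i) Es in sc cc uc.
case: s {Es} sc cc uc mins => [//|y s] /=; case: (lastP s) => [//|t z] _.
rewrite rcons_path last_rcons => /andP[xy /andP[_ zx]] /and3P[_ yt _] mins.
have yz : y = z.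
  apply: (rP x) => //; first by rewrite adj_sym.
    by apply: mins; rewrite mem_head.
  by apply: mins; rewrite inE mem_rcons mem_head orbT.
by rewrite yz mem_rcons mem_head in yt.
Qed.

(** Links cardinalities over ordinals to counts over lists of numbers, the form in which the
    computations are done. *)
Lemma sum_ord_count n (P : pred nat) :
  (\sum_(x < n) P x)%N = count P (iota 0 n).
Proof.
rewrite -[X in iota _ X](subn0 n) -/(index_iota 0 n) -sum1_count.
by rewrite [RHS]big_mkcond big_mkord; apply: eq_bigr => x _; case: (P x).
Qed.

(** * Disjoint copies: order, forest number and minimum degree *)

Section Copies.

Variable k : nat.

Definition copies_adj : rel ('I_k * 'I_31) :=
  fun x y => (x.1 == y.1) && badj x.2 y.2.

Lemma copies_adj_sym : symmetric copies_adj.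
Proof. by move=> x y; rewrite /copies_adj eq_sym badj_sym. Qed.

Lemma copies_adj_irrefl : irreflexive copies_adj.
Proof. by move=> x; rewrite /copies_adj badj_irrefl andbF. Qed.

Definition copies : sgraph := SGraph copies_adj_sym copies_adj_irrefl.

Lemma card_copies : #|copies| = (31 * k)%N.
Proof. by rewrite card_prod !card_ord mulnC. Qed.

Lemma card_copies_set (F : {set copies}) :
  #|F| = (\sum_(i < k) \sum_(x < 31) ((i, x) \in F))%N.
Proof.
rewrite pair_bigA /= -sum1_card [LHS]big_mkcond; apply: eq_bigr => -[i x] _ /=.
by case: ((i, x) \in F).
Qed.

(** In each copy the vertices outside [F] hit all cycles, so at least 16 of the 31 lie outside and
    at most 15 inside. *)
Lemma acyclic_card (F : {set copies}) :
  acyclic (induced_subgraph F) -> (#|F| <= 15 * k)%N.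
Proof.
move=> acF; rewrite card_copies_set.
rewrite (_ : 15 * k = \sum_(i < k) 15)%N; last first.
  by rewrite sum_nat_const card_ord mulnC.
apply: leq_sum => i _.
(* [inord] sends numbers from 31 on to a default vertex. This is harmless: a vertex of a cycle is
   adjacent to its successor, hence below 31. *)
pose S (x : nat) := (i, inord x : 'I_31) \notin F.
have hS : hits_cycles S.
  move=> c sc /andP[cc uc].
  have lt31 x : x \in c -> (x < 31)%N.
    by move=> xc; apply: (@badj_lt x (next c x)); apply: next_cycle.
  have : has [pred p | p \notin F] [seq (i, inord x : 'I_31) : copies | x <- c].
    apply: acyclic_hits acF _ _; first by rewrite size_map.
    apply/andP; split.
      rewrite cycle_map; have c_c : all (mem c) c by apply/allP.
      apply: sub_in_cycle c_c cc => x y xc yc xy /=.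
      by rewrite /copies_adj /= eqxx !inordK ?lt31.
    rewrite map_inj_in_uniq // => x y xc yc [].
    by move/(congr1 (@nat_of_ord 31)); rewrite !inordK ?lt31.
  by rewrite has_map.
rewrite (eq_bigr (fun x : 'I_31 => predC S x : nat)) => [|x _]; last first.
  by rewrite /= /S negbK inord_val.
rewrite sum_ord_count; have := hits_cycles_count hS.
have := count_predC S (iota 0 31); rewrite size_iota.
move: (count S _) (count (predC S) _) => m n; lia.
Qed.

(* Listed in such an order that every vertex has at most one neighbour further
   on in the list. *)
Definition forest15 : seq nat :=
  [:: 6; 13; 8; 15; 16; 10; 7; 1; 0; 24; 19; 23; 21; 22; 28].

Definition copies_forest : {set copies} :=
  [set x : copies | (x.2 : nat) \in forest15].

(** The rank of a vertex is its position in [forest15]. Adjacent vertices share a copy, so the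
    criterion reduces to a finite check on triples from the list. *)
Lemma copies_forest_acyclic : acyclic (induced_subgraph copies_forest).
Proof.
pose r x := index x forest15.
have /allP rP : all (fun x => all (fun y => all (fun z =>
    [&& badj x y, badj x z, (r x <= r y)%N & (r x <= r z)%N] ==> (y == z))
    forest15) forest15) forest15 by lazy.
apply: (@rank_acyclic (induced_subgraph copies_forest) (fun x => r (val x).2)).
move=> [[i x] /= xF] [[j y] /= yF] [[l z] /= zF]; rewrite /copies_adj /=.
move=> /andP[/eqP ij xy] /andP[/eqP il xz] rxy rxz; apply: val_inj => /=.
rewrite -ij -il; congr pair; apply/val_inj/eqP.
move: xF yF zF; rewrite !finset.in_set => xF yF zF.
have /allP/(_ _ yF)/allP/(_ _ zF)/implyP := rP _ xF.
by apply; rewrite xy xz rxy.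
Qed.

Lemma card_copies_forest : #|copies_forest| = (15 * k)%N.
Proof.
rewrite card_copies_set (eq_bigr (fun=> 15%N)); last first.
  move=> i _; rewrite (eq_bigr (fun x : 'I_31 => (val x \in forest15) : nat)).
    by rewrite (@sum_ord_count _ (mem forest15)).
  by move=> x _; rewrite inE.
by rewrite sum_nat_const card_ord mulnC.
Qed.

Lemma forest_number_copies : forest_number copies = (15 * k)%N.
Proof.
apply/eqP; rewrite eqn_leq; apply/andP; split.
  by apply/bigmax_leqP => F /asboolP; apply: acyclic_card.
rewrite -card_copies_forest; apply: leq_bigmax_cond.
by apply/asboolP; apply: copies_forest_acyclic.
Qed.

Lemma degree_copies (x : copies) :
  degree x = count (badj (x.2 : nat)) (iota 0 31).
Proof.
case: x => i x; rewrite /degree card_copies_set -sum_ord_count (bigD1 i) //=.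
(* No neighbour lies in another copy. *)
rewrite [X in (_ + X)%N]big1 => [|j ji]; last first.
  by apply: big1 => y _; rewrite inE /= /copies_adj /= eq_sym (negbTE ji).
rewrite addn0; apply: eq_bigr => y _.
by rewrite inE /= /copies_adj eqxx.
Qed.

Lemma min_degree_copies : (0 < k)%N -> min_degree copies = 5%N.
Proof.
move=> k_gt0.
have deg5 : all (fun x => 5 <= count (badj x) (iota 0 31))%N (iota 0 31).
  by lazy.
apply/eqP; rewrite eqn_leq; apply/andP; split.
  (* Vertex 6 has exactly the neighbours 0, 2, 5, 9 and 11. *)
  pose x : copies := (Ordinal k_gt0, inord 6).
  have <- : degree x = 5%N by rewrite degree_copies inordK.
  have : x \in index_enum copies by rewrite mem_index_enum.
  rewrite /min_degree; elim: (index_enum copies) => // y s IH.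
  rewrite inE big_cons => /orP[/eqP <-|/IH]; first exact: geq_minl.
  by move=> le_s; rewrite geq_min le_s orbT.
apply: (big_ind (fun d => (5 <= d)%N)) => [|m n m5 n5|x _].
(* The default value of the minimum is the order [31 * k], at least 5 as [k] is positive. *)
- by rewrite card_copies; lia.
- by rewrite leq_min m5.
- by rewrite degree_copies; apply: (allP deg5); rewrite mem_iota /=.
Qed.

End Copies.

(** * Straight segments in the plane and their intersections *)

Section Drawing.

Variable R : realType.

Implicit Types a b c d q : R * R.

(** Twice the signed area of the triangle [a b c]: its sign tells the side of the line [a b] on
    which [c] lies, and it vanishes for collinear points. *)
Definition cross a b c : R :=
  (b.1 - a.1) * (c.2 - a.2) - (b.2 - a.2) * (c.1 - a.1).

Definition point_at a b (t : R) : R * R :=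
  (a.1 + t * (b.1 - a.1), a.2 + t * (b.2 - a.2)).

Definition segment a b : set (R * R) := (point_at a b @` `[0, 1])%classic.

Lemma segment_sym a b : segment a b = segment b a.
Proof.
suff sub a' b' : (segment a' b' `<=` segment b' a')%classic.
  by apply/seteqP; split.
move=> q [t /=]; rewrite in_itv /= => /andP[t0 t1] <-.
exists (1 - t); first by rewrite /= in_itv /=; apply/andP; split; lra.
by rewrite /point_at; congr pair; ring.
Qed.

Lemma segment_is_arc a b : a != b -> is_arc a b (segment a b).
Proof.
move=> ab; exists (point_at a b); split => //.
- apply: continuous_subspaceT => t.
  have cvg_coord (u v : R) : (u + s * v @[s --> t] --> u + t * v)%classic.
    apply: cvgD; first exact: cvg_cst.
    by apply: cvgM; [exact: cvg_id | exact: cvg_cst].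
  exact: (cvg_pair (cvg_coord _ _) (cvg_coord _ _)).
- move=> s t _ _ [/addrI E1 /addrI E2].
  (* If [s] and [t] differed, both coordinates of [b - a] would vanish, since [s - t] annihilates
     them. *)
  apply/eqP; rewrite -subr_eq0; apply: contraNT ab => st.
  have e1 : (s - t) * (b.1 - a.1) = 0 by rewrite mulrBl E1 subrr.
  have e2 : (s - t) * (b.2 - a.2) = 0 by rewrite mulrBl E2 subrr.
  move/eqP: e1; rewrite mulf_eq0 (negbTE st) subr_eq0 /= => /eqP e1.
  move/eqP: e2; rewrite mulf_eq0 (negbTE st) subr_eq0 /= => /eqP e2.
  by apply/eqP; case: a b e1 e2 {E1 E2} => [? ?] [? ?] /= -> ->.
- by rewrite /point_at !mul0r !addr0; case: a {ab}.
- by case: a b {ab} => [? ?] [? ?]; rewrite /point_at /=; congr pair; ring.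
Qed.

Lemma cross_point_at a b c d t :
  cross a b (point_at c d t) = (1 - t) * cross a b c + t * cross a b d.
Proof. by rewrite /cross /point_at /=; ring. Qed.

Lemma cross_segment a b q : segment a b q -> cross a b q = 0.
Proof. by move=> [t _ <-]; rewrite /cross /point_at /=; ring. Qed.

(** Vertical strips are convex; this will confine each copy to its own strip. *)
Lemma segment_fst (l u : R) a b q :
  l <= a.1 <= u -> l <= b.1 <= u -> segment a b q -> l <= q.1 <= u.
Proof.
move=> /andP[la au] /andP[lb bu] [t /=].
rewrite in_itv /= => /andP[t0 t1] <- /=.
by apply/andP; split; nra.
Qed.

(** Along the segment [c d] the signed area is a convex combination of two nonzero numbers of equal
    sign. *)
Lemma segment_side a b c d q :
  0 < cross a b c * cross a b d -> segment c d q -> cross a b q != 0.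
Proof.
move=> s [t /=]; rewrite in_itv /= => /andP[t0 t1] <-; rewrite cross_point_at.
move: (cross a b c) (cross a b d) s => x y s.
apply/eqP => E.
(* Multiplying by [x] makes both terms nonnegative, whatever the sign of [x]; they cannot vanish
   together. *)
have {}E : (1 - t) * x ^+ 2 + t * (x * y) = 0.
  by rewrite -[RHS](mulr0 x) -E; ring.
have x2 : 0 < x ^+ 2.
  by rewrite exprn_even_gt0 //=; apply: contraTneq s => ->; rewrite mul0r ltxx.
have x2t : 0 <= (1 - t) * x ^+ 2 by apply: mulr_ge0; lra.
have [t_gt0|t_le0] := ltrP 0 t.
  by have := mulr_gt0 t_gt0 s; lra.
have t_eq0 : t = 0 by lra.
by move: E; rewrite t_eq0 subr0 mul1r mul0r addr0; lra.
Qed.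

Lemma segments_disjoint a b c d :
  0 < cross a b c * cross a b d \/ 0 < cross c d a * cross c d b ->
  (segment a b `&` segment c d = set0)%classic.
Proof.
move=> H; rewrite -subset0 => q [abq cdq].
case: H => H.
  by move/eqP: (segment_side H cdq); apply; apply: cross_segment.
by move/eqP: (segment_side H abq); apply; apply: cross_segment.
Qed.

(** At parameter [t] of the segment [a c] the signed area is [t * cross a b c], so the line [a b] is
    met only at [t = 0]. *)
Lemma segments_common_end a b c q :
  cross a b c != 0 -> segment a b q -> segment a c q -> q = a.
Proof.
move=> abc /cross_segment abq [t _ E]; move: abq; rewrite -E cross_point_at.
have -> : cross a b a = 0 by rewrite /cross; ring.
move/eqP; rewrite mulr0 add0r mulf_eq0 (negbTE abc) orbF => /eqP t0.
by rewrite /point_at t0 !mul0r !addr0; case: a {abc E}.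
Qed.

End Drawing.

(** * An integer drawing of one copy, verified by evaluation *)

(** The outer face is the triangle 1 2 3, with corners (0, 0), (200, 0) and (100, 200). *)
Definition points : seq (Z * Z) :=
  [:: (101, 72); (0, 0); (200, 0); (100, 200); (50, 96); (62, 20); (135, 24);
  (98, 1); (151, 1); (158, 8); (88, 14); (109, 15); (121, 4); (131, 5); (143,
  8); (133, 11); (110, 13); (110, 10); (125, 10); (87, 102); (99, 137); (76,
  148); (95, 170); (68, 120); (90, 124); (85, 119); (93, 148); (82, 145); (89,
  153); (82, 134); (88, 135)]%coqZ.

Definition point (x : nat) : Z * Z := nth (0, 0)%coqZ points x.

Definition Zcross (a b c : Z * Z) : Z :=
  ((b.1 - a.1) * (c.2 - a.2) - (b.2 - a.2) * (c.1 - a.1))%coqZ.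

(** The hypothesis of [segments_disjoint] as a test that evaluates. *)
Definition Zseparated (a b c d : Z * Z) : bool :=
  (0 <? Zcross a b c * Zcross a b d)%coqZ
  || (0 <? Zcross c d a * Zcross c d b)%coqZ.

Definition for_edges (P : nat -> nat -> bool) : bool :=
  all (fun x => all (P x) (nth [::] neighbours x)) (iota 0 31).

Lemma for_edgesP (P : nat -> nat -> bool) x y :
  for_edges P -> badj x y -> P x y.
Proof.
move=> /allP/(_ x) Px xy; move: Px; rewrite mem_iota (badj_lt xy) => /(_ isT).
by move/allP/(_ y); apply.
Qed.

(** General position serves twice: it keeps vertices off the edges, and it makes edges with a common
    end meet only there. *)
Lemma points_general :
  for_edges (fun x y => all (fun z =>
    [|| z == x, z == y | ~~ (Zcross (point x) (point y) (point z) =? 0)%coqZ])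
    (iota 0 31)).
Proof. by lazy. Qed.

Lemma points_separated :
  for_edges (fun x y => for_edges (fun z t =>
    [|| x == z, x == t, y == z, y == t
      | Zseparated (point x) (point y) (point z) (point t)])).
Proof. by lazy. Qed.

Lemma points_bounded :
  all (fun a => (0 <=? a.1)%coqZ && (a.1 <=? 200)%coqZ) points.
Proof. by lazy. Qed.

Lemma points_uniq : uniq points.
Proof. by lazy. Qed.

(** * Planarity of the copies, drawn side by side *)

Section PlanarCopies.

Variable R : realType.

Definition ZtoR (z : Z) : R := (int_of_Z z)%:~R.

Lemma ZtoR_inj : injective ZtoR.
Proof. by move=> x y /intr_inj /(can_inj int_of_ZK). Qed.

Lemma ZtoR_gt0 z : (0 <? z)%coqZ -> 0 < ZtoR z.
Proof. by move/Z.ltb_lt => z_gt0; rewrite ltr0z; lia. Qed.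

Lemma ZtoR_le x y : (x <=? y)%coqZ -> ZtoR x <= ZtoR y.
Proof. by move/Z.leb_le => xy; rewrite ler_int; lia. Qed.

Lemma ZtoRB x y : ZtoR (x - y)%coqZ = ZtoR x - ZtoR y.
Proof. by rewrite /ZtoR (rmorphB int_of_Z) intrB. Qed.

Lemma ZtoRM x y : ZtoR (x * y)%coqZ = ZtoR x * ZtoR y.
Proof. by rewrite /ZtoR (rmorphM int_of_Z) intrM. Qed.

Variable k : nat.

(* 201 exceeds the width of the drawing of one copy. *)
Definition place (x : copies k) : R * R :=
  (ZtoR (point x.2).1 + 201 * (x.1 : nat)%:R, ZtoR (point x.2).2).

(** Translation preserves differences of coordinates, so the integer checks on one copy hold in
    every copy. *)
Lemma cross_place (i : 'I_k) (x y z : 'I_31) :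
  cross (place (i, x)) (place (i, y)) (place (i, z)) =
    ZtoR (Zcross (point x) (point y) (point z)).
Proof. by rewrite /cross /Zcross !ZtoRB !ZtoRM !ZtoRB /=; ring. Qed.

Lemma place_fst (x : copies k) :
  201 * (x.1 : nat)%:R <= (place x).1 <= 201 * (x.1 : nat)%:R + 200.
Proof.
case: x => i x /=.
have /(allP points_bounded)/andP[/ZtoR_le l0 /ZtoR_le u0] : point x \in points.
  exact: mem_nth.
have := l0; have := u0; rewrite /ZtoR /= => *; apply/andP; split; lra.
Qed.

Lemma same_copy (i j : 'I_k) (u : R) :
  201 * (i : nat)%:R <= u <= 201 * (i : nat)%:R + 200 ->
  201 * (j : nat)%:R <= u <= 201 * (j : nat)%:R + 200 -> i = j.
Proof.
suff le (m n : nat) : 201 * m%:R <= u -> u <= 201 * n%:R + 200 -> (m <= n)%N.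
  move=> /andP[l1 u1] /andP[l2 u2]; apply/val_inj/eqP; rewrite eqn_leq /=.
  by rewrite (le _ _ l1 u2) (le _ _ l2 u1).
(* If [n < m], then [201 * m] is at least [201 * n + 201], beyond the strip of copy [n]. *)
move=> lu ul; rewrite leqNgt; apply/negP => nm.
have : (n.+1%:R : R) <= m%:R by rewrite ler_nat.
by rewrite -natr1; lra.
Qed.

Lemma place_inj : injective place.
Proof.
move=> [i x] [j y] E.
have ij : i = j.
  by apply: same_copy (place_fst (i, x)) _; rewrite E; apply: place_fst (j, y).
case: E; rewrite ij => /addIr/ZtoR_inj E1 /ZtoR_inj E2.
congr pair; apply/val_inj/eqP.
have lt_pts (z : 'I_31) : (z < size points)%N by exact: ltn_ord.
rewrite -(nth_uniq (0, 0)%coqZ (lt_pts x) (lt_pts y) points_uniq).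
by apply/eqP; apply: injective_projections.
Qed.

Lemma segment_copy (i : 'I_k) (x y : 'I_31) q :
  segment (place (i, x)) (place (i, y)) q ->
  201 * (i : nat)%:R <= q.1 <= 201 * (i : nat)%:R + 200.
Proof. exact: segment_fst (place_fst (i, x)) (place_fst (i, y)). Qed.

Lemma cross_edge (i : 'I_k) (x y z : 'I_31) :
  badj x y -> z != x -> z != y ->
  cross (place (i, x)) (place (i, y)) (place (i, z)) != 0.
Proof.
move=> xy zx zy; rewrite cross_place.
have /allP/(_ (z : nat)) := for_edgesP points_general xy.
rewrite mem_iota /= ltn_ord => /(_ isT).
rewrite !val_eqE (negbTE zx) (negbTE zy) /=.
by apply: contraNneq => /(@ZtoR_inj _ 0%coqZ) ->.
Qed.

Lemma edges_common_end (i : 'I_k) (x y z : 'I_31) q :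
  badj x y -> badj x z -> y != z ->
  segment (place (i, x)) (place (i, y)) q ->
  segment (place (i, x)) (place (i, z)) q -> q = place (i, x).
Proof.
move=> xy xz yz; apply/segments_common_end/cross_edge; rewrite // eq_sym //.
by apply: contraTneq xz => ->; rewrite badj_irrefl.
Qed.

Lemma planar_copies : planar R (copies k).
Proof.
exists place, (fun x y => segment (place x) (place y)).
split; first exact: place_inj.
- move=> x y xy; split; first exact: segment_sym.
  apply: segment_is_arc; rewrite (inj_eq place_inj).
  by apply: contraTneq xy => ->; rewrite adj_irrefl.
- move=> [i x] [j y] [l z] /andP[/= /eqP <-{j} xy] [] zxy.
  (* A vertex lying on an edge is in the strip of that edge, hence in the same copy. *)
  have il : i = l := same_copy (segment_copy zxy) (place_fst (l, z)).
  rewrite -il in zxy *; apply.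
  have [->|zx] := eqVneq z x; first by left.
  have [->|zy] := eqVneq z y; first by right.
  by have := cross_segment zxy; move/eqP; rewrite (negbTE (cross_edge _ _ _ _)).
- move=> [i x] [j y] [l z] [m t].
  move=> /andP[/= /eqP <-{j} xy] /andP[/= /eqP <-{m} zt] ne.
  rewrite -subset0 => q [[xyq nq] ztq]; apply: nq.
  have il : i = l := same_copy (segment_copy xyq) (segment_copy ztq).
  rewrite -il in ne ztq *.
  have yx : badj y x by rewrite badj_sym.
  have tz : badj t z by rewrite badj_sym.
  (* Edges with a common end: both segments are oriented to start there, and [q] must be that end.
     The first two cases take the distinctness of the other ends from [ne], the last two from the
     earlier cases. *)
  have [xz|xz] := eqVneq x z.
    left; rewrite -xz in ne ztq zt tz *.
    apply: edges_common_end xyq ztq => //.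
    by apply: contraNneq ne => ->.
  have [xt|xt] := eqVneq x t.
    left; rewrite -xt in ne ztq zt tz *.
    rewrite segment_sym in ztq; apply: edges_common_end xyq ztq => //.
    by apply: contraNneq ne => ->; rewrite finset.setUC.
  have [yz|yz] := eqVneq y z.
    right; rewrite -yz in ne ztq zt tz *.
    by rewrite segment_sym in xyq; apply: edges_common_end xyq ztq.
  have [yt|yt] := eqVneq y t.
    right; rewrite -yt in ne ztq zt tz *.
    rewrite segment_sym in xyq; rewrite segment_sym in ztq.
    by apply: edges_common_end xyq ztq.
  (* With four distinct ends, the integer separation test makes the segments disjoint, so [q] cannot
     exist. *)
  have := for_edgesP (for_edgesP points_separated xy) zt.
  rewrite !val_eqE (negbTE xz) (negbTE xt) (negbTE yz) (negbTE yt) /=.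
  move=> sep; suff : (segment (place (i, x)) (place (i, y)) `&`
      segment (place (i, z)) (place (i, t)))%classic q.
    by rewrite segments_disjoint //; case/orP: sep => /ZtoR_gt0;
      rewrite ZtoRM -!(cross_place i); [left | right].
  by split.
Qed.

End PlanarCopies.

Theorem theorem1p1 (R : realType) (k : nat) (hk : (2 <= k)%N) :
  exists M : sgraph,
    [/\ planar R M,
        #|M| = (31 * k)%N,
        forest_number M = (15 * k)%N,
        (forest_number M)%:R / #|M|%:R = 15 / 31 :> rat &
        min_degree M = 5%N].
Proof.
have k_gt0 : (0 < k)%N by exact: ltnW.
exists (copies k); split.
- exact: planar_copies.
- exact: card_copies.
- exact: forest_number_copies.
(* The common factor [k] is nonzero and cancels. *)
- rewrite forest_number_copies card_copies !natrM -mulf_div divff ?mulr1 //.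
  by rewrite pnatr_eq0 -lt0n.
- exact: min_degree_copies.
Qed.
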